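(* Let $k, l, s$ be positive integers. Let $m_1, \dots, m_s \in \mathbb{N}$ and $a_1, \dots, a_s \in \mathbb{N}$ satisfy $\gcd(m_i, m_j) = 1$ for all $i \neq j$, and $\gcd(a_i, m_i) = 1$ for all $i = 1, \dots, s$. Put $m = m_1 m_2 \cdots m_s$ and $M_i = m/m_i$ for $i = 1, \dots, s$. For each $i$ let $\overline{M}_i$ be a positive integer with $\overline{M}_i M_i \equiv 1 \pmod{m_i}$. Let $r_1, \dots, r_s$ be positive integers satisfying $r_i \equiv a_i M_i \overline{M}_i \pmod{m}$ for $i = 1, \dots, s$. Define \[ \mathcal{A} := \{ r_1 j_1 + r_2 j_2 + \cdots + r_s j_s + mk\, j_{s+1} : 0 \le j_i \le m_i - 1 \ (i = 1, \dots, s),\ 0 \le j_{s+1} \le l-1 \} \] and \[ \mathcal{B} := (mk\mathbb{N} \setminus mkl\mathbb{N}) \cup \bigcup_{i=1}^{s} (r_i \mathbb{N} \setminus r_i m_i \mathbb{N}). \] Then $P(\mathcal{A}; n) = Q(\mathcal{B}; n)$ for all $n \in \mathbb{N}$.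
   Context: $\mathbb{N} = \{1, 2, 3, \dots\}$. For $a \in \mathbb{N}$, $a\mathbb{N} = \{an : n \in \mathbb{N}\}$, and $X \setminus Y$ is set difference. A partition of $n$ is a finite non-increasing sequence of positive integers (parts) summing to $n$; the multiplicity of a part is the number of times it occurs. For $\mathcal{A} \subseteq \mathbb{N} \cup \{0\}$, $P(\mathcal{A}; n)$ denotes the number of partitions of $n$ in which the multiplicity of every part (that occurs) belongs to $\mathcal{A}$. For $\mathcal{B} \subseteq \mathbb{N}$, $Q(\mathcal{B}; n)$ denotes the number of partitions of $n$ all of whose parts belong to $\mathcal{B}$. By convention $P(\mathcal{A}; 0) = Q(\mathcal{B}; 0) = 1$. *)

(* Defs.v *)
From HB Require Import structures.
From mathcomp Require Import all_boot.
From mathcomp Require Import boolp classical_sets.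

Set Implicit Arguments.
Unset Strict Implicit.
Unset Printing Implicit Defensive.

Definition is_intpart (n : nat) (p : seq nat) : bool :=
  [&& sorted geq p, all (fun x => 0 < x) p & sumn p == n].

Record intpart (n : nat) : predArgType :=
  IntPart { intpart_val :> seq nat; intpart_valP : is_intpart n intpart_val }.

HB.instance Definition _ n := [isSub for @intpart_val n].
HB.instance Definition _ n := [Countable of intpart n by <:].

Lemma size_sumn (p : seq nat) : all (fun x => 0 < x) p -> size p <= sumn p.
Proof. by elim: p => //= x p IH /andP[x0 /IH h]; rewrite -add1n leq_add. Qed.

Lemma mem_leq_sumn (p : seq nat) (x : nat) : x \in p -> x <= sumn p.
Proof.
elim: p => //= y p IH; rewrite inE => /orP[/eqP->|/IH h].
  exact: leq_addr.
by rewrite (leq_trans h) ?leq_addl.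
Qed.

(* [intpart n] is finite: a partition of [n] has at most [n] parts, each at most [n], so partitions
   embed into the finite type [n.-bseq 'I_n.+1]. *)
Definition intpart_code (n : nat) (p : intpart n) : n.-bseq 'I_n.+1 :=
  insub_bseq n [seq inord x | x <- p].

Definition intpart_decode (n : nat) (b : n.-bseq 'I_n.+1) : option (intpart n) :=
  insub [seq val i | i <- b].

Lemma intpart_codeK (n : nat) : pcancel (@intpart_code n) (@intpart_decode n).
Proof.
move=> p; rewrite /intpart_decode /intpart_code.
have /and3P[_ p0 /eqP pn] := intpart_valP p.
have sz : size [seq inord x : 'I_n.+1 | x <- p] <= n.
  by rewrite size_map -[X in _ <= X]pn size_sumn.
rewrite /insub_bseq val_insubd sz -map_comp map_id_in ?valK // => x xp.
by rewrite /= inordK // ltnS -pn mem_leq_sumn.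
Qed.

HB.instance Definition _ n : isFinite (intpart n) :=
  PCanIsFinite (@intpart_codeK n).

Local Open Scope classical_set_scope.

Definition partP (A : set nat) (n : nat) : nat :=
  #|[pred p : intpart n | all (fun x => count_mem x p \in A) p]|.

Definition partQ (B : set nat) (n : nat) : nat :=
  #|[pred p : intpart n | all (fun x => x \in B) p]|.

Definition pos_multiples (a : nat) : set nat :=
  [set a * n | n in [set n | 0 < n]].

Definition setA (s : nat) (ms r : 'I_s -> nat) (m k l : nat) : set nat :=
  [set x | exists (j : 'I_s -> nat) (j' : nat),
    [/\ forall i, j i <= ms i - 1,
        j' <= l - 1 &
        x = \sum_(i < s) r i * j i + m * k * j']].

Definition setB (s : nat) (ms r : 'I_s -> nat) (m k l : nat) : set nat :=
  (pos_multiples (m * k) `\` pos_multiples (m * k * l)) `|`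
  \bigcup_(i in [set: 'I_s])
    (pos_multiples (r i) `\` pos_multiples (r i * ms i)).

(* Main.v *)
Require Import Defs.
From mathcomp Require Import all_boot.
From mathcomp Require Import all_algebra.
From mathcomp Require Import boolp classical_sets.

(** Modulo [ms i], [r i] is a unit and every other [r j], as well as [m * k], is [0]. Hence the
    digits of an element of [A] are unique, so that [sum_(c in A) x^(t c)] is the product of the
    finite geometric series [(1 - x^(t r m)) / (1 - x^(t r))] over the pairs [(r, m)] equal to
    [(r i, ms i)] or [(m k, l)]. For the same reason the sets [r N \ r m N] are disjoint. The product
    over all [t >= 1] of these quotients is therefore the product of [1 / (1 - x^b)] over [b] in
    [B]. All identities are read in [rat[x]] modulo [x^(n+1)], with denominators cleared. *)

(** * Partitions as vectors of multiplicities *)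

Lemma sumn_count n (p : seq nat) :
  {in p, forall x, 0 < x <= n} ->
  sumn p = \sum_(i < n) i.+1 * count_mem i.+1 p.
Proof.
elim: p => [|x p IH] xP /=; first by rewrite big1 // => i _; rewrite muln0.
rewrite IH; last by move=> y yp; apply: xP; rewrite inE yp orbT.
under [RHS]eq_bigr do rewrite mulnDr.
rewrite [RHS]big_split; congr (_ + _).
have /andP[x0 xn] := xP x (mem_head _ _).
have xn' : x.-1 < n by rewrite prednK.
rewrite (bigD1 (Ordinal xn')) //= big1 ?addn0 => [|i ne].
  by rewrite prednK // eqxx muln1.
rewrite (_ : (x == i.+1) = false) ?muln0 //; apply/negP => /eqP E.
by case/negP: ne; apply/eqP/val_inj; rewrite /= E.
Qed.

Lemma intpart_mem n (p : intpart n) : {in intpart_val p, forall x, 0 < x <= n}.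
Proof.
have /and3P[_ /allP p0 /eqP pn] := intpart_valP p.
by move=> x xp; rewrite (p0 x xp) -[X in _ <= X]pn mem_leq_sumn.
Qed.

Lemma leq_count_intpart n (p : intpart n) x : count_mem x p <= n.
Proof.
have /and3P[_ p0 /eqP pn] := intpart_valP p.
by rewrite (leq_trans (count_size _ _)) // -[X in _ <= X]pn size_sumn.
Qed.

(** Index [i] stands for the part [i.+1]; no multiplicity exceeds [n], so [inord] loses nothing. *)
Definition mult_vector n (p : intpart n) : {ffun 'I_n -> 'I_n.+1} :=
  [ffun i : 'I_n => inord (count_mem i.+1 p)].

Lemma mult_vectorE n (p : intpart n) i :
  mult_vector n p i = count_mem (i : nat).+1 p :> nat.
Proof. by rewrite ffunE inordK // ltnS leq_count_intpart. Qed.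

(** Equal multiplicities make two partitions permutations of each other, and sorted permutations
    coincide. *)
Lemma mult_vector_inj n : injective (mult_vector n).
Proof.
move=> p q pq; apply: val_inj => /=.
have /and3P[sp _ _] := intpart_valP p; have /and3P[sq _ _] := intpart_valP q.
apply: (@sorted_eq _ geq) => //.
- by move=> x y z /= xy /leq_trans; apply.
- by move=> x y /= /andP[xy yx]; apply/eqP; rewrite eqn_leq xy yx.
apply/allP => x xpq.
have /andP[x0 xn] : 0 < x <= n.
  by move: xpq; rewrite mem_cat => /orP[]; apply: intpart_mem.
have xn' : x.-1 < n by rewrite prednK.
by have := mult_vectorE n p (Ordinal xn'); rewrite pq mult_vectorE /= prednK // => ->.
Qed.

Lemma mult_vector_onto n (f : {ffun 'I_n -> 'I_n.+1}) :
  \sum_(i < n) i.+1 * f i = n -> exists p, mult_vector n p = f.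
Proof.
move=> fn.
pose u := flatten [seq nseq (f i) i.+1 | i : 'I_n <- enum 'I_n].
have uP : {in u, forall x, 0 < x <= n}.
  by move=> x /flatten_mapP[i _]; rewrite mem_nseq => /andP[_ /eqP->] /=.
have uC (i : 'I_n) : count_mem i.+1 u = f i.
  rewrite /u count_flatten -map_comp sumnE big_map big_enum /=.
  rewrite (bigD1 i) //= big1 => [|j ji]; rewrite count_nseq /=.
    by rewrite eqxx mul1n addn0.
  by rewrite eqSS (inj_eq val_inj) (negbTE ji).
have pP : is_intpart n (sort geq u).
  apply/and3P; split.
  - by apply: sort_sorted => x y; apply: leq_total.
  - by rewrite all_sort; apply/allP => x /uP/andP[].
  - rewrite (perm_sumn (permEl (perm_sort _ _))) (sumn_count n) //.
    by under eq_bigr do rewrite uC; rewrite fn.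
exists (IntPart pP); apply/ffunP => i; apply: val_inj.
by rewrite /= mult_vectorE /= (permP (permEl (perm_sort _ _))).
Qed.

(** Since [S t 0] holds, the condition on the parts that occur can be imposed on all of [1..n]. *)
Lemma card_intpart_mult n (S : nat -> pred nat) (S0 : forall t, S t 0) :
  #|[pred p : intpart n | all (fun x => S x (count_mem x p)) p]| =
  #|[pred f : {ffun 'I_n -> 'I_n.+1} |
      [forall i : 'I_n, S i.+1 (f i)] && (\sum_(i < n) i.+1 * f i == n)]|.
Proof.
rewrite -(card_imset _ (mult_vector_inj n)); apply: eq_card => f.
apply/imsetP/andP => [[p pS ->]|[/forallP fS /eqP fn]].
  have /and3P[_ _ /eqP pn] := intpart_valP p.
  split; last first.
    apply/eqP; under eq_bigr do rewrite mult_vectorE.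
    by rewrite -sumn_count //; exact: intpart_mem.
  apply/forallP => i; rewrite mult_vectorE.
  have [ip|ip] := boolP (i.+1 \in intpart_val p); last by rewrite (count_memPn ip).
  exact: (allP pS).
have [p pf] := mult_vector_onto n f fn; exists p => //.
apply/allP => x xp; have /andP[x0 xn] := intpart_mem n p x xp.
have xn' : x.-1 < n by rewrite prednK.
by have := fS (Ordinal xn'); rewrite -pf mult_vectorE /= prednK.
Qed.

(** * Congruence of polynomials modulo a power of ['X] *)

Import GRing.Theory Num.Theory.
Local Open Scope ring_scope.

Section TruncatedSeries.

Variable N : nat.
Implicit Types p q : {poly rat}.

Definition eqX p q := p %% 'X^N = q %% 'X^N.

Lemma eqX_refl p : eqX p p.
Proof. by []. Qed.

Lemma eqX_eq p q : p = q -> eqX p q.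
Proof. by move->. Qed.

Lemma eqX_sym p q : eqX p q -> eqX q p.
Proof. exact: esym. Qed.

Lemma eqX_trans p q s : eqX p q -> eqX q s -> eqX p s.
Proof. exact: eq_trans. Qed.

Lemma eqXM p p' q q' : eqX p p' -> eqX q q' -> eqX (p * q) (p' * q').
Proof.
by rewrite /eqX => pp qq; rewrite -modp_mul qq modp_mul mulrC -modp_mul pp modp_mul mulrC.
Qed.

Lemma eqX_prod (I : Type) (s : seq I) (P : pred I) (F G : I -> {poly rat}) :
  (forall i, P i -> eqX (F i) (G i)) ->
  eqX (\prod_(i <- s | P i) F i) (\prod_(i <- s | P i) G i).
Proof. by move=> FG; apply: (big_ind2 eqX) => // *; apply: eqXM. Qed.

Lemma eqX_Xn k : (N <= k)%N -> eqX 'X^k 0.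
Proof. by move=> /dvdp_exp2l-/(_ rat 'X)/modp_eq0; rewrite /eqX mod0p. Qed.

Lemma eqXD p p' q q' : eqX p p' -> eqX q q' -> eqX (p + q) (p' + q').
Proof. by rewrite /eqX !modpD => -> ->. Qed.

Lemma eqX_sum (I : Type) (s : seq I) (P : pred I) (F G : I -> {poly rat}) :
  (forall i, P i -> eqX (F i) (G i)) ->
  eqX (\sum_(i <- s | P i) F i) (\sum_(i <- s | P i) G i).
Proof. by move=> FG; apply: (big_ind2 eqX) => // *; apply: eqXD. Qed.

Lemma eqX_1BXn k : (N <= k)%N -> eqX (1 - 'X^k) 1.
Proof.
by move=> /eqX_Xn; rewrite /eqX modpD modpN => ->; rewrite mod0p subr0.
Qed.

(** A polynomial with nonzero constant term is coprime to ['X^N]; this stands in for division of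
    power series. *)
Lemma eqX_cancel d p q : d.[0] != 0 -> eqX (p * d) (q * d) -> eqX p q.
Proof.
move=> d0 /eqP; rewrite /eqX -subr_eq0 -modpN -modpD -mulNr -mulrDl => dv.
have cop : coprimep 'X^N d.
  by rewrite coprimep_expl // coprimep_sym coprimepX /root.
move: dv; rewrite -/('X^N %| _) (Gauss_dvdpl _ cop) /dvdp modpD modpN subr_eq0.
by move/eqP.
Qed.

Lemma eqX_coef p q k : (k < N)%N -> eqX p q -> p`_k = q`_k.
Proof.
move=> kN pq; rewrite (divp_eq p 'X^N) (divp_eq q 'X^N) -pq !coefD !coefMXn.
by rewrite kN.
Qed.

End TruncatedSeries.

Arguments eqX_trans {N p} q {s}.
Arguments eqXM {N p p' q q'}.
#[local] Hint Resolve eqX_refl : core.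

(** * Generating polynomials and products over multiples *)

Definition mult_poly n (S : nat -> pred nat) : {poly rat} :=
  \prod_(i < n) \sum_(c < n.+1 | S i.+1 c) 'X^(i.+1 * c).

(** Expanding the product chooses a multiplicity for each part; multiplicities and parts above [n]
    cannot contribute to degree [n]. *)
Lemma card_intpart_coef n (S : nat -> pred nat) (S0 : forall t, S t 0%N) :
  #|[pred p : intpart n | all (fun x => S x (count_mem x p)) p]|%:R
  = (mult_poly n S)`_n.
Proof.
rewrite card_intpart_mult // /mult_poly.
rewrite bigA_distr_big_dep coef_sum -sum1_card natr_sum /= big_mkcondr.
apply: eq_big => [f|f _].
  by apply/forallP/familyP => fS i; have := fS i.
by rewrite prodrXr coefXn eq_sym; case: eqP.
Qed.

Lemma geom_sumX b c :
  (\sum_(j < c) 'X^(b * j)) * (1 - 'X^b) = 1 - 'X^(b * c) :> {poly rat}.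
Proof.
rewrite -[1 - 'X^(b * c)]opprB exprM subrX1 -mulNr opprB mulrC.
by congr (_ * _); apply: eq_bigr => j _; rewrite exprM.
Qed.

(** Factors of exponent above [n] are 1 modulo ['X^n.+1]; the others run over the multiples of [d]
    up to [n]. *)
Lemma prod_multiples n d (d0 : (0 < d)%N) :
  eqX n.+1 (\prod_(t < n) (1 - 'X^(t.+1 * d)))
           (\prod_(b < n | (d %| b.+1)%N) (1 - 'X^(b.+1))).
Proof.
have td t : (0 < t.+1 * d)%N by rewrite muln_gt0.
(* Each factor becomes a product over at most one [b], empty when [t.+1 * d] exceeds [n], so that
   the two products can be exchanged. *)
apply: (eqX_trans (\prod_(t < n) \prod_(b < n | (b : nat) == (t.+1 * d).-1)
  (1 - 'X^(b.+1)))).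
  apply: eqX_prod => t _.
  rewrite (big_ord1_eq _ (fun b => 1 - 'X^(b.+1))) prednK //.
  by case: leqP => // ?; apply: eqX_1BXn.
apply: eqX_eq.
rewrite (exchange_big_dep (fun b : 'I_n => (d %| b.+1)%N)) /=; last first.
  by move=> t b _ /eqP->; rewrite prednK // dvdn_mull.
apply: eq_bigr => b /dvdnP[[//|q] bq].
have qn : (q < n)%N.
  by rewrite (leq_trans _ (ltn_ord b)) // bq leq_pmulr.
rewrite (big_pred1 (Ordinal qn)) // => t /=.
rewrite -eqSS prednK // bq eqn_pmul2r // eqSS eq_sym.
by rewrite -(inj_eq val_inj).
Qed.

(** * The identity for an abstract system of unique digits and disjoint sieves *)

Section GeneralTheorem.

Variables (I : finType) (r m : I -> nat) (A B : set nat) (n : nat).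
Hypothesis r_gt0 : forall i, (0 < r i)%N.
Hypothesis m_gt0 : forall i, (0 < m i)%N.
Hypothesis digits_inj : forall j j' : I -> nat,
  (forall i, (j i < m i)%N) -> (forall i, (j' i < m i)%N) ->
  (\sum_i r i * j i = \sum_i r i * j' i)%N -> j =1 j'.
Let sieve i b := (r i %| b)%N && ~~ (r i * m i %| b)%N.
Hypothesis sieve_disjoint : forall b i i', sieve i b -> sieve i' b -> i = i'.
Hypothesis AE : forall x, A x <->
  exists2 j : I -> nat, forall i, (j i < m i)%N & x = (\sum_i r i * j i)%N.
Hypothesis BE : forall b, (0 < b)%N -> B b <-> exists i, sieve i b.

(** Expanding the right side gives one monomial per digit vector; by uniqueness of digits each
    element of [A] arises once, and those above [n] vanish. *)
Lemma prod_digits t (t0 : (0 < t)%N) :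
  eqX n.+1 (\sum_(c < n.+1 | (c : nat) \in A) 'X^(t * c))
           (\prod_i \sum_(j < m i) 'X^(t * r i * j)).
Proof.
(* A common bound on the digits puts all digit vectors into one finite function type. *)
pose K := \max_i m i.
pose fam := family (fun i (j : 'I_K) => (j < m i)%N).
pose phi (f : {ffun I -> 'I_K}) := (\sum_i r i * f i)%N.
have -> : \prod_i \sum_(j < m i) 'X^(t * r i * j)
          = \sum_(f in fam) 'X^(t * phi f) :> {poly rat}.
  under eq_bigr => i _ do
    rewrite (big_ord_widen K (fun j => 'X^(t * r i * j))) ?leq_bigmax //.
  rewrite bigA_distr_big_dep.
  apply: eq_bigr => f _; rewrite prodrXr /phi big_distrr /=.
  by under eq_bigr do rewrite -mulnA.
apply: eqX_sym; apply: (eqX_trans (\sum_(f in fam)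
  \sum_(c < n.+1 | (c : nat) == phi f) 'X^(t * c))).
  apply: eqX_sum => f _.
  rewrite (big_ord1_eq _ (fun c => 'X^(t * c))).
  by case: leqP => // nf; apply: eqX_Xn; rewrite (leq_trans nf) // leq_pmull.
apply: eqX_eq.
have famA (f : {ffun I -> 'I_K}) : f \in fam -> phi f \in A.
  by move=> /familyP ff; rewrite in_setE; apply/AE; exists (fun i => f i).
rewrite (exchange_big_dep (fun c : 'I_n.+1 => (c : nat) \in A)) /=; last first.
  by move=> f c ff /eqP->; apply: famA.
apply: eq_bigr => c; rewrite in_setE => /AE[j jm cj].
have jK i : (j i < K)%N by apply: leq_trans (jm i) _; apply: leq_bigmax.
pose f0 : {ffun I -> 'I_K} := [ffun i => Ordinal (jK i)].
have f0E i : f0 i = j i :> nat by rewrite ffunE.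
rewrite (big_pred1 f0) // => f /=; apply/andP/eqP => [[/familyP ff /eqP cf]|->].
  apply/ffunP => i; apply: val_inj; rewrite /= f0E.
  by apply: (digits_inj (fun i => f i)) => //; rewrite -cj cf.
split; first by apply/familyP => i; rewrite unfold_in f0E.
by rewrite cj /phi; under [X in _ == X]eq_bigr do rewrite f0E.
Qed.

(** Modulo ['X^n.+1], [D' / D] is the generating series for multiplicities in [A], and [1 / W] the
    one for parts in [B]. *)
Let D : {poly rat} := \prod_i \prod_(t < n) (1 - 'X^(t.+1 * r i)).
Let D' : {poly rat} := \prod_i \prod_(t < n) (1 - 'X^(t.+1 * (r i * m i))).
Let W : {poly rat} := \prod_(b < n | (b.+1 : nat) \in B) (1 - 'X^(b.+1)).

Lemma mult_polyA : eqX n.+1 (mult_poly n (fun _ c => c \in A) * D) D'.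
Proof.
rewrite /D /D' exchange_big [X in eqX _ _ X]exchange_big /= /mult_poly -big_split.
apply: eqX_prod => t _ /=.
apply: eqX_trans (eqXM (prod_digits t.+1 isT) (eqX_refl _ _)) _.
apply: eqX_eq; rewrite -big_split /=; apply: eq_bigr => i _.
by rewrite geom_sumX mulnA.
Qed.

Lemma prod_sieve : W = \prod_i \prod_(b < n | sieve i b.+1) (1 - 'X^(b.+1)).
Proof.
rewrite (exchange_big_dep (fun b : 'I_n => (b.+1 : nat) \in B)) /=; last first.
  by move=> i b _ ib; rewrite in_setE; apply/BE => //; exists i.
apply: eq_bigr => b; rewrite in_setE => /BE-/(_ isT)[i ib].
rewrite (big_pred1 i) // => i' /=; apply/idP/eqP => [i'b|-> //].
exact: sieve_disjoint i'b ib.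
Qed.

(** The multiples of [r i] split into those of [r i * m i] and the sieve of [i]. *)
Lemma prod_multiples_sieve : eqX n.+1 D (D' * W).
Proof.
rewrite prod_sieve -big_split; apply: eqX_prod => i _ /=.
apply: eqX_trans (prod_multiples n (r i) (r_gt0 i)) _.
rewrite (bigID (fun b : 'I_n => (r i * m i %| b.+1)%N)) /=.
apply: eqXM => //; apply: eqX_sym.
apply: eqX_trans (prod_multiples n _ _) _; first by rewrite muln_gt0 r_gt0 m_gt0.
apply: eqX_eq; apply: eq_bigl => b.
case: (boolP (r i * m i %| _)%N) => [h|_]; last by rewrite andbF.
by rewrite (dvdn_trans (dvdn_mulr _ (dvdnn _)) h).
Qed.

(** For a part in [B] the geometric sum telescopes to [1 - 'X^(b.+1 * n.+1)], which is 1 here; any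
    other part contributes only the term [c = 0]. *)
Lemma mult_polyB :
  eqX n.+1 (mult_poly n (fun t c => (t \in B) || (c == 0%N)) * W) 1.
Proof.
rewrite /mult_poly /W [X in _ * X]big_mkcond -big_split /=.
rewrite [X in eqX _ _ X](_ : 1 = \prod_(b < n) 1); last by rewrite big1.
apply: eqX_prod => b _; case: ifP => bB /=.
  by rewrite geom_sumX; apply: eqX_1BXn; rewrite leq_pmull.
by rewrite (big_ord1_eq _ (fun c => 'X^(b.+1 * c))) /= muln0 expr0 mulr1.
Qed.

Lemma D_at0_neq0 : D.[0] != 0.
Proof.
rewrite horner_prod; apply/prodf_neq0 => i _.
rewrite horner_prod; apply/prodf_neq0 => t _.
by rewrite hornerD hornerN hornerXn hornerC expr0n gtn_eqF ?subr0 ?oner_neq0 ?muln_gt0 ?r_gt0.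
Qed.

Lemma partP_eq_partQ : partP A n = partQ B n.
Proof.
apply/eqP; rewrite -(eqr_nat rat).
have A0 : 0%N \in A.
  by rewrite in_setE; apply/AE; exists (fun=> 0%N) => //; rewrite big1 // => i _; rewrite muln0.
rewrite /partP (card_intpart_coef n (fun _ c => c \in A)) //.
(* The added alternative is void for parts that occur; it turns the condition on parts into one on
   multiplicities that admits 0. *)
have -> : partQ B n = #|[pred p : intpart n |
    all (fun x => (x \in B) || (count_mem x p == 0%N)) p]|.
  apply: eq_card => p; rewrite !inE; apply: eq_in_all => x xp.
  by rewrite -leqn0 leqNgt -has_count has_pred1 xp orbF.
rewrite (card_intpart_coef n (fun t c => (t \in B) || (c == 0%N))) => [|t]; last first.
  by rewrite eqxx orbT.
(* After multiplication by [D] both sides become [D']. *)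
apply/eqP/(eqX_coef n.+1) => //; apply: (eqX_cancel _ D _ _ D_at0_neq0).
apply: eqX_trans mult_polyA _; apply: eqX_sym.
apply: eqX_trans (eqXM (eqX_refl _ _) prod_multiples_sieve) _.
rewrite mulrCA -[X in eqX _ _ X]mulr1; apply: eqXM => //; exact: mult_polyB.
Qed.

End GeneralTheorem.

Local Close Scope ring_scope.

(** * Divisibility and the residues [r i] modulo each [ms i] *)

Lemma eqn_modMl_coprime d x y z :
  coprime d x -> x * y = x * z %[mod d] -> y = z %[mod d].
Proof.
move=> dx.
wlog zy : y z / z <= y => [W E|].
  by case/orP: (leq_total z y) => zy; [|apply/esym]; apply: W.
move/eqP; rewrite eqn_mod_dvd ?leq_mul2l ?zy ?orbT // -mulnBr Gauss_dvdr //.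
by rewrite -eqn_mod_dvd // => /eqP.
Qed.

Lemma pos_multiplesE d x : 0 < x -> pos_multiples d x <-> d %| x.
Proof.
move=> x0; split=> [[q _ <-]|/dvdnP[q xq]]; first exact: dvdn_mulr.
by exists q => /=; [move: x0; rewrite xq muln_gt0 => /andP[]|rewrite xq mulnC].
Qed.

Section ChineseResidues.

Variables (s : nat) (ms a M Mbar r : 'I_s -> nat) (m : nat).
Hypothesis ham : forall i, gcdn (a i) (ms i) = 1.
Hypothesis hms : forall i, 0 < ms i.
Hypothesis hm : m = \prod_(i < s) ms i.
Hypothesis hM : forall i, M i = m %/ ms i.
Hypothesis hMMbar : forall i, Mbar i * M i = 1 %[mod ms i].
Hypothesis hra : forall i, r i = a i * M i * Mbar i %[mod m].

Lemma dvdn_modulus i : ms i %| m.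
Proof. by rewrite hm (bigD1 i) //= dvdn_mulr. Qed.

Lemma residue_mod i j : r j = a j * M j * Mbar j %[mod ms i].
Proof.
by rewrite -(modn_dvdm (r j) (dvdn_modulus i)) hra modn_dvdm ?dvdn_modulus.
Qed.

(** For [i != j] the cofactor [M j] still contains the factor [ms i]. *)
Lemma dvdn_residue i j : i != j -> ms i %| r j.
Proof.
move=> ij; rewrite /dvdn residue_mod -/(dvdn _ _) -mulnA dvdn_mull // dvdn_mulr //.
rewrite hM hm (bigD1 j) //= mulKn // (bigD1 i) //=.
exact: dvdn_mulr.
Qed.

(** Modulo [ms i] the factors [M i] and [Mbar i] cancel, leaving [a i]. *)
Lemma coprime_residue i : coprime (ms i) (r i).
Proof.
rewrite -coprime_modr residue_mod -mulnA [M i * _]mulnC -modnMmr hMMbar modnMmr muln1.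
by rewrite coprime_modr coprime_sym; apply/eqP/ham.
Qed.

Lemma digit_sum_mod i (f : 'I_s -> nat) e :
  ms i %| e -> \sum_(j < s) r j * f j + e = r i * f i %[mod ms i].
Proof.
move=> ie; rewrite (bigD1 i) //= -addnA -modnDmr.
rewrite (_ : (_ + e) %% ms i = 0) ?addn0 //; apply/eqP.
rewrite -/(dvdn _ _) dvdn_add // dvdn_sum // => j ji.
by rewrite dvdn_mulr // dvdn_residue // eq_sym.
Qed.

End ChineseResidues.

(** * The digit system formed by the residues and [m * k] *)

Theorem theorem1p7
  (k l s : nat) (hk : 0 < k) (hl : 0 < l) (hs : 0 < s)
  (ms a : 'I_s -> nat)
  (hms : forall i, 0 < ms i) (ha : forall i, 0 < a i)
  (hmm : forall i j, i <> j -> gcdn (ms i) (ms j) = 1)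
  (ham : forall i, gcdn (a i) (ms i) = 1)
  (m : nat) (hm : m = \prod_(i < s) ms i)
  (M : 'I_s -> nat) (hM : forall i, M i = m %/ ms i)
  (Mbar : 'I_s -> nat) (hMbar : forall i, 0 < Mbar i)
  (hMMbar : forall i, Mbar i * M i = 1 %[mod ms i])
  (r : 'I_s -> nat) (hr : forall i, 0 < r i)
  (hra : forall i, r i = a i * M i * Mbar i %[mod m])
  (n : nat) (hn : 0 < n) :
  partP (setA ms r m k l) n = partQ (setB ms r m k l) n.
Proof.
have leq_subn1 x y : 0 < y -> (x <= y - 1) = (x < y).
  by move=> y0; rewrite subn1 -ltnS prednK.
have mk0 : 0 < m * k by rewrite muln_gt0 hk hm prodn_gt0.
have dvd_r := dvdn_residue s ms a M Mbar r m hms hm hM hra.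
have cop_r := coprime_residue s ms a M Mbar r m ham hm hMMbar hra.
have mod_sum := digit_sum_mod s ms a M Mbar r m hms hm hM hra.
have dvd_mk i x : ms i %| m * k * x by rewrite -mulnA dvdn_mulr // (dvdn_modulus s ms m hm).
(* The extra index [inr tt] carries the pair [(m * k, l)]. *)
pose R (o : 'I_s + unit) := if o is inl i then r i else m * k.
pose ML (o : 'I_s + unit) := if o is inl i then ms i else l.
have sumE (j : 'I_s + unit -> nat) :
    \sum_o R o * j o = \sum_(i < s) r i * j (inl i) + m * k * j (inr tt).
  by rewrite big_sumType /= (big_pred1 tt) // => -[].
have dvd_R i o : o != inl i -> ms i %| R o.
  case: o => [i' ii'|_ _] /=; last by rewrite -[m * k]muln1.
  by apply: dvd_r; apply: contraNneq ii' => ->.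
apply: (partP_eq_partQ _ R ML).
- by case.
- by case.
- move=> j j' jl j'l; rewrite !sumE => E.
  (* Reduction modulo [ms i] isolates digit [i], whose coefficient is a unit; the last digit then
     follows by cancelling [m * k]. *)
  have jE i : j (inl i) = j' (inl i).
    rewrite -(modn_small (jl (inl i))) -(modn_small (j'l (inl i))).
    apply: (eqn_modMl_coprime _ _ _ _ (cop_r i)).
    rewrite -(mod_sum i (fun i => j (inl i)) _ (dvd_mk i (j (inr tt)))) E.
    exact: mod_sum.
  case=> [i|[]]; first exact: jE.
  move: E; under eq_bigr do rewrite jE.
  by move/addnI/eqP; rewrite eqn_pmul2l // => /eqP.
(* If [o] differs from [inl i], then [ms i] divides [R o] and so [b]; being coprime to [r i], it
   would give [r i * ms i %| b]. *)
- have key b i o : R (inl i) %| b -> ~~ (R (inl i) * ML (inl i) %| b) -> R o %| b -> inl i = o.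
    move=> /= rb nb ob; apply/eqP/negPn; apply: contra nb; rewrite eq_sym => oi.
    by rewrite Gauss_dvd 1?coprime_sym // rb (dvdn_trans (dvd_R _ _ oi)).
  move=> b [i|[]] [i'|[]] // /andP[h1 h2] /andP[h3 h4]; first exact: key h2 h3.
    exact: key h2 h3.
  by apply/esym; apply: key h4 h1.
- move=> x; split=> [[j [j' [jm jl ->]]]|[j jm ->]].
    exists (fun o => if o is inl i then j i else j').
      by case=> [i|[]] /=; rewrite -leq_subn1.
    by rewrite sumE.
  exists (fun i => j (inl i)), (j (inr tt)); split; last by rewrite sumE.
    by move=> i; rewrite leq_subn1 //; apply: (jm (inl i)).
  by rewrite leq_subn1 //; apply: (jm (inr tt)).
move=> b b0; split=> [[[/pos_multiplesE-/(_ b0) h1 h2]|[i _ [/pos_multiplesE-/(_ b0) h1 h2]]]|].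
- by exists (inr tt); rewrite h1; apply/negP => /pos_multiplesE-/(_ b0).
- by exists (inl i); rewrite h1; apply/negP => /pos_multiplesE-/(_ b0).
case=> -[i|[]] /= /andP[h1 /negP h2]; [right; exists i => //|left]; split.
all: by [apply/pos_multiplesE|move=> /pos_multiplesE-/(_ b0)].
Qed.
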